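(* A strictly convex real Banach space $X$ is a Hilbert space (i.e., its norm is induced by an inner product) if and only if for every two-dimensional subspace $Y$ of $X$, the pair $(Y,Y)$ has L-P property.
   Context: All spaces are real. For a normed space $Z$, $B_Z$ is the closed unit ball and $E_Z$ is the set of all extreme points of $B_Z$. $L(Z,W)$ is the space of all bounded linear operators from $Z$ to $W$ with the usual operator norm. An operator $T\in L(Z,W)$ is an extreme contraction if it is an extreme point of the unit ball $B_{L(Z,W)}$. For Banach spaces $Z,W$, the pair $(Z,W)$ has L-P (Lindenstrauss–Perles) property if for every $T\in L(Z,W)$ with $\|T\|=1$: $T$ is an extreme contraction if and only if $T(E_Z)\subseteq E_W$. Subspaces of $X$ carry the restricted norm. *)

(* Defs.v *)
From HB Require Import structures.
From mathcomp Require Import all_boot all_order all_algebra.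
From mathcomp Require Import sesquilinear.
From mathcomp Require Import all_classical all_reals all_analysis.

Set Implicit Arguments.
Unset Strict Implicit.
Unset Printing Implicit Defensive.

Import Order.TTheory GRing.Theory Num.Theory.
Import numFieldNormedType.Exports.

Local Open Scope classical_set_scope.
Local Open Scope ring_scope.

Definition extreme_points {R : realType} (V : lmodType R) (A : set V) : set V :=
  [set x | A x /\ forall (y z : V) (t : R), A y -> A z -> 0 < t < 1 ->
     x = (1 - t) *: y + t *: z -> y = x /\ z = x].

Definition unit_ball {R : realType} (Z : normedModType R) : set Z :=
  [set z | `|z| <= 1].
Arguments unit_ball {R} Z.

Definition unit_sphere {R : realType} (Z : normedModType R) : set Z :=
  [set z | `|z| = 1].
Arguments unit_sphere {R} Z.

Definition strictly_convex {R : realType} (Z : normedModType R) : Prop :=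
  unit_sphere Z `<=` extreme_points (unit_ball Z).

(* With theta = idfun, a dot form is a symmetric bilinear form that is
   positive on nonzero vectors. *)
Definition is_hilbert {R : realType} (Z : completeNormedModType R) : Prop :=
  exists dot : {dot Z for idfun}, forall z : Z, `|z| = Num.sqrt (dot z z).

Section Operators.
Context {R : realType}.

(* L(Z, W) is carved out of the vector space Z -> W of all functions, whose
   operations are pointwise. *)
Definition bounded_operators (Z W : normedModType R) : set (Z -> W) :=
  [set T | linear T /\ exists M : R, forall z : Z, `|T z| <= M * `|z|].

(* On bounded_operators this is the supremum of a nonempty bounded set; the
   value on other functions is junk. *)
Definition opnorm (Z W : normedModType R) (T : Z -> W) : R :=
  sup [set `|T z| | z in unit_ball Z].

Definition operator_unit_ball (Z W : normedModType R) : set (Z -> W) :=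
  [set T | bounded_operators T /\ opnorm T <= 1].

Definition extreme_contraction (Z W : normedModType R) (T : Z -> W) : Prop :=
  extreme_points (@operator_unit_ball Z W) T.

Definition LP_property (Z W : normedModType R) : Prop :=
  forall T : Z -> W, bounded_operators T -> opnorm T = 1 ->
    (extreme_contraction T <->
     T @` extreme_points (unit_ball Z) `<=` extreme_points (unit_ball W)).

End Operators.

Section Subspaces.
Context {R : realType} {X : normedModType R} (Y : submodClosed X).

Record subspace_of := SubspaceOf { subspace_val : X; _ : subspace_val \in Y }.

HB.instance Definition _ := [isSub for subspace_val].
HB.instance Definition _ := [Choice of subspace_of by <:].
HB.instance Definition _ := [SubChoice_isSubLmodule of subspace_of by <:].

Definition subspace_norm (y : subspace_of) : R := `|val y|.

Lemma subspace_normD (x y : subspace_of) :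
  subspace_norm (x + y) <= subspace_norm x + subspace_norm y.
Proof. by rewrite /subspace_norm raddfD ler_normD. Qed.

Lemma subspace_normZ (a : R) (x : subspace_of) :
  subspace_norm (a *: x) = `|a| * subspace_norm x.
Proof. by rewrite /subspace_norm linearZ normrZ. Qed.

Lemma subspace_norm0_eq0 (x : subspace_of) : subspace_norm x = 0 -> x = 0.
Proof.
by rewrite /subspace_norm => /normr0_eq0 x0; apply: val_inj; rewrite raddf0.
Qed.

HB.instance Definition _ := @Lmodule_isNormed.Build R subspace_of
  subspace_norm subspace_normD subspace_normZ subspace_norm0_eq0.

End Subspaces.

Definition has_dimension {R : realType} (V : lmodType R) (n : nat) : Prop :=
  exists e : 'I_n -> V,
    (forall c : 'I_n -> R, \sum_i c i *: e i = 0 -> forall i, c i = 0) /\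
    (forall v : V, exists c : 'I_n -> R, v = \sum_i c i *: e i).

(* Main.v *)
(* In a Hilbert plane, |v|^2 - |Tv|^2 is a positive semidefinite quadratic form,
   degenerate when |T| = 1, hence the square of a linear form l.  If l <> 0, let
   k span its kernel and let y be orthogonal to Tk: then T + h l y and T - h l y
   are contractions for small h > 0, and T is not extreme.

   Conversely, let Y be a strictly convex plane with the L-P property.  For unit
   vectors x, y, the contractions sending x to y form a nonempty compact face of
   the unit ball of L(Y, Y); an extreme point of this face is an extreme
   contraction, hence an isometry.  So the isometries of Y act transitively on
   the unit sphere.  They preserve the quadratic form of maximal determinant
   dominated by the squared norm (the Loewner ellipse), which is unique; this
   form is then constant on the sphere, so the norm of Y is Euclidean.  On the
   whole space one concludes as Jordan and von Neumann did. *)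

Require Import Defs.
From HB Require Import structures.
From mathcomp Require Import all_boot all_order all_algebra.
From mathcomp Require Import sesquilinear ring lra.
From mathcomp Require Import all_classical all_reals all_analysis.

Set Implicit Arguments.
Unset Strict Implicit.
Unset Printing Implicit Defensive.

Import Order.TTheory GRing.Theory Num.Theory.
Import numFieldNormedType.Exports.

Local Open Scope classical_set_scope.
Local Open Scope ring_scope.

(** * Bases, coordinates and linear maps in a plane *)

Lemma scaler_comb2 (R : realType) (V : lmodType R) (p q a b c d : R) (x y : V) :
  p *: (a *: x + b *: y) + q *: (c *: x + d *: y) =
  (p * a + q * c) *: x + (p * b + q * d) *: y.
Proof. by rewrite !scalerDr !scalerA addrACA -!scalerDl. Qed.

(** Explicit pairs replace families over ['I_2], so that planar computations reduce to [ring] and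
    [field]; [has_dimension2P] is the bridge. *)
Definition is_basis2 (R : realType) (V : lmodType R) (x y : V) : Prop :=
  (forall v, exists a b : R, v = a *: x + b *: y) /\
  (forall a b : R, a *: x + b *: y = 0 -> a = 0 /\ b = 0).

Section Basis2.
Context {R : realType} {V : lmodType R}.
Implicit Types (x y : V) (a b c d : R).

Lemma is_basis2_sym x y : is_basis2 x y -> is_basis2 y x.
Proof.
case=> gen ind; split=> [v|a b].
  by have [a [b ->]] := gen v; exists b, a; rewrite addrC.
by rewrite addrC => /ind[-> ->].
Qed.

Lemma is_basis2_inj x y a b c d : is_basis2 x y ->
  a *: x + b *: y = c *: x + d *: y -> a = c /\ b = d.
Proof.
case=> _ ind /eqP; rewrite -subr_eq0 opprD addrACA -!scalerBl => /eqP /ind.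
by case=> /eqP + /eqP; rewrite !subr_eq0 => /eqP -> /eqP ->.
Qed.

Lemma is_basis2_neq0 x y : is_basis2 x y -> x != 0.
Proof.
case=> _ ind; apply/eqP => x0; have [] := ind 1 0.
  by rewrite x0 scaler0 scale0r addr0.
by move/eqP; rewrite oner_eq0.
Qed.

Lemma is_basis2_subst x y a b : is_basis2 x y -> a != 0 ->
  is_basis2 (a *: x + b *: y) y.
Proof.
move=> xy a0; have combE p q :
    p *: (a *: x + b *: y) + q *: y = (p * a) *: x + (p * b + q) *: y.
  by rewrite scalerDr !scalerA -addrA -scalerDl.
split=> [v|p q].
  have [s [t ->]] := xy.1 v; exists (s / a), (t - s / a * b).
  by rewrite combE; congr (_ *: _ + _ *: _); field.
rewrite combE => /xy.2[/eqP]; rewrite mulf_eq0 (negbTE a0) orbF => /eqP ->.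
by rewrite mul0r add0r.
Qed.

(** The common shape of the support basis and of Gram-Schmidt: project out [x], then rescale. *)
Lemma is_basis2_shift x y s b : is_basis2 x y -> b != 0 ->
  is_basis2 x (b *: (y - s *: x)).
Proof.
move=> /is_basis2_sym/(@is_basis2_subst _ _ b (- (b * s))) H /H.
by move/is_basis2_sym; rewrite scalerBr scalerA scaleNr.
Qed.

Lemma has_dimension2P : has_dimension V 2 <-> exists x y, is_basis2 x y.
Proof.
split=> [[e [ind gen]]|[x [y [gen ind]]]].
  exists (e ord0), (e ord_max); split=> [v|a b ab0].
    have [c ->] := gen v; exists (c ord0), (c ord_max).
    by rewrite big_ord_recl big_ord1; congr (_ + c _ *: e _); apply/val_inj.
  pose c (i : 'I_2) := if i == ord0 then a else b.
  have /ind c0 : \sum_i c i *: e i = 0.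
    rewrite big_ord_recl big_ord1 -[RHS]ab0 /c /=.
    by congr (_ + _ *: e _); apply/val_inj.
  by split; [exact: (c0 ord0)|exact: (c0 ord_max)].
exists (fun i => if i == ord0 then x else y); split=> [c|v].
  rewrite big_ord_recl big_ord1 /= => /ind[c0 c1] i.
  have [->//|i0] := eqVneq i ord0.
  rewrite -[RHS]c1; congr c; apply/val_inj => /=.
  by case: i i0 => -[|[|]].
have [a [b ->]] := gen v; exists (fun i => if i == ord0 then a else b).
by rewrite big_ord_recl big_ord1.
Qed.

Lemma extend_basis2 x : has_dimension V 2 -> x != 0 ->
  exists y, is_basis2 x y.
Proof.
move=> /has_dimension2P[e1 [e2 e12]].
have [a [b ->]] := e12.1 x.
have [->|a0 _] := eqVneq a 0; last first.
  by exists e2; exact: is_basis2_subst.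
have [->|b0 _] := eqVneq b 0; first by rewrite !scale0r addr0 eqxx.
exists e1; rewrite addrC; apply: is_basis2_subst => //.
exact: is_basis2_sym.
Qed.

(** Choice provides the coordinates; their uniqueness makes them linear. *)
Lemma is_basis2_coord x y : is_basis2 x y ->
  exists f g : V -> R,
  [/\ forall v, v = f v *: x + g v *: y,
      forall a b, f (a *: x + b *: y) = a,
      forall a b, g (a *: x + b *: y) = b,
      forall a b u v, f (a *: u + b *: v) = a * f u + b * f v &
      forall a b u v, g (a *: u + b *: v) = a * g u + b * g v].
Proof.
move=> xy; have /choice[f fP] := xy.1; have /choice[g fgP] := fP.
have fgE a b : f (a *: x + b *: y) = a /\ g (a *: x + b *: y) = b.
  by apply: (is_basis2_inj xy); rewrite -fgP.
exists f, g; split=> //; try by move=> a b; have [] := fgE a b.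
  move=> a b u v; rewrite {1}(fgP u) {1}(fgP v) scaler_comb2.
  by have [] := fgE (a * f u + b * f v) (a * g u + b * g v).
move=> a b u v; rewrite {1}(fgP u) {1}(fgP v) scaler_comb2.
by have [] := fgE (a * f u + b * f v) (a * g u + b * g v).
Qed.

End Basis2.

Lemma linear_comb2 (R : realType) (V W : lmodType R) (T : V -> W) :
  linear T -> forall (a b : R) (u v : V),
  T (a *: u + b *: v) = a *: T u + b *: T v.
Proof.
move=> lT a b u v; rewrite lT; congr (_ + _).
have T0 : T 0 = 0.
  by have := lT (-1) 0 0; rewrite scaler0 addr0 scaleN1r addNr.
by have := lT b v 0; rewrite !addr0 T0 addr0.
Qed.

Lemma linearZ_fun (R : realType) (V W : lmodType R) (T : V -> W) :
  linear T -> forall (a : R) (v : V), T (a *: v) = a *: T v.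
Proof.
by move=> lT a v; have := linear_comb2 lT a 0 v v; rewrite !scale0r !addr0.
Qed.

(** * Operator norm, contractions and extreme points *)

Section OperatorNorm.
Context {R : realType} {V W : normedModType R}.
Implicit Types T : V -> W.

Lemma opnorm_ge T v : bounded_operators T -> `|v| <= 1 -> `|T v| <= opnorm T.
Proof.
move=> [_ [M TM]] v1; apply: ub_le_sup; last by exists v.
exists `|M| => _ [z z1 <-]; apply: le_trans (TM z) _.
apply: (@le_trans _ _ (`|M| * `|z|)); first by rewrite ler_wpM2r ?ler_norm.
by rewrite ler_piMr.
Qed.

Lemma opnorm_le T (c : R) : 0 <= c -> (forall v, `|T v| <= c * `|v|) ->
  opnorm T <= c.
Proof.
move=> c0 Tc; apply: ge_sup; first by exists `|T 0|, 0; rewrite // /unit_ball /= normr0.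
by move=> _ [z z1 <-]; apply: le_trans (Tc z) _; rewrite ler_piMr.
Qed.

Lemma opnorm_le1 T : bounded_operators T ->
  opnorm T <= 1 -> forall v, `|T v| <= `|v|.
Proof.
move=> bT T1 v; have [->|v0] := eqVneq v 0.
  have [lT _] := bT; have := linearZ_fun lT 0 0.
  by rewrite !scale0r => ->; rewrite normr0.
have nv : 0 < `|v| by rewrite normr_gt0.
have vE : v = `|v| *: (`|v|^-1 *: v) by rewrite scalerA mulfV ?gt_eqF// scale1r.
rewrite {1}vE linearZ_fun; last by case: bT.
rewrite normrZ normr_id ler_piMr //.
apply: le_trans T1; apply: opnorm_ge => //.
by rewrite normrZ normfV normr_id mulVf ?gt_eqF.
Qed.

Lemma contraction_unit_ball T : linear T -> (forall v, `|T v| <= `|v|) ->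
  operator_unit_ball T.
Proof.
move=> lT T1; split; first by split=> //; exists 1 => v; rewrite mul1r.
by apply: opnorm_le => // v; rewrite mul1r.
Qed.

End OperatorNorm.

(** Every unit vector [v] is extreme by strict convexity, so [T v] is extreme too and cannot be
    split: [A] and [B] agree with [T] on the sphere, hence everywhere by homogeneity. *)
Lemma isometry_extreme_contraction (R : realType) (V W : normedModType R)
    (T : V -> W) : strictly_convex V ->
  bounded_operators T -> opnorm T = 1 ->
  T @` extreme_points (unit_ball V) `<=` extreme_points (unit_ball W) ->
  extreme_contraction T.
Proof.
move=> scV bT T1 TE; split; first by split; rewrite ?T1.
move=> A B t [bA A1] [bB B1] t01 TAB.
have sphere v : `|v| = 1 -> A v = T v /\ B v = T v.
  move=> v1; have [|_] := TE (T v); first by exists v => //; exact: scV.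
  apply; [| |exact: t01|by rewrite TAB];
    by rewrite /unit_ball /= -v1; exact: opnorm_le1.
have [lT _] := bT; have [lA _] := bA; have [lB _] := bB.
suff AB : forall v, A v = T v /\ B v = T v.
  by split; apply: funext => v; have [Av Bv] := AB v.
move=> v; have [->|v0] := eqVneq v 0.
  by rewrite -(scale0r 0) !linearZ_fun// !scale0r.
have nv : 0 < `|v| by rewrite normr_gt0.
have vE : v = `|v| *: (`|v|^-1 *: v) by rewrite scalerA mulfV ?gt_eqF// scale1r.
have [|Av Bv] := sphere (`|v|^-1 *: v).
  by rewrite normrZ normfV normr_id mulVf ?gt_eqF.
by rewrite vE linearZ_fun// (linearZ_fun lB) (linearZ_fun lT) Av Bv.
Qed.

(* A non-unit point w is the midpoint of w + e u and w - e u. *)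
Lemma extreme_point_unit (R : realType) (V : normedModType R) (u w : V) :
  u != 0 -> extreme_points (unit_ball V) w -> `|w| = 1.
Proof.
move=> u0 [w1 wE]; apply/eqP; rewrite eq_le w1 leNgt; apply/negP => w1'.
have nu : 0 < `|u| by rewrite normr_gt0.
pose e := (1 - `|w|) / `|u|.
have e0 : 0 < e by rewrite divr_gt0// subr_gt0.
have eu : `|e *: u| = 1 - `|w|.
  by rewrite normrZ gtr0_norm// divfK// gt_eqF.
have [||||+ _] := wE (w + e *: u) (w - e *: u) 2^-1.
- by rewrite /unit_ball /= (le_trans (ler_normD _ _))// eu addrCA subrr addr0.
- by rewrite /unit_ball /= (le_trans (ler_normB _ _))// eu addrCA subrr addr0.
- by apply/andP; split; lra.
- have -> : 1 - 2^-1 = 2^-1 :> R by field.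
  rewrite -scalerDr addrACA subrr addr0 -mulr2n -(scaler_nat 2 w) scalerA.
  by rewrite mulVf ?scale1r// pnatr_eq0.
move/(canRL (addKr _)); rewrite addNr => /eqP.
by rewrite scaler_eq0 (gt_eqF e0) (negbTE u0).
Qed.

(** Serves twice: to find an extreme point of a face of contractions, and the form of maximal
    determinant. *)
Lemma compact_maximizer (R : realType) (T : topologicalType) (K C : set T) (f : T -> R) :
  K !=set0 -> closed K -> compact C -> K `<=` C -> continuous f ->
  exists2 c, K c & forall t, K t -> f t <= f c.
Proof.
move=> K0 clK cC KC cf.
have cK : compact K by exact: subclosed_compact clK cC KC.
have [|c] := compact_EVT_max K0 cK (f := f).
  exact: continuous_subspaceT.
rewrite inE => Kc fc; exists c => // t Kt; apply: fc.
by rewrite inE.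
Qed.

(** * Supporting functionals in a plane *)

Section TwoDimensional.
Context {R : realType} {V : normedModType R}.
Implicit Types x y z w v : V.

(* One step of the Hahn-Banach extension, for the functional a x |-> a. *)
Lemma unit_functional_extension x z : `|x| = 1 ->
  exists s : R, forall a b : R, `|a + b * s| <= `|a *: x + b *: z|.
Proof.
move=> x1; pose S := [set a - `|a *: x - z| | a in [set: R]].
have cross (a c : R) : a - `|a *: x - z| <= `|c *: x + z| - c.
  rewrite lerBrDr addrAC lerBlDr.
  apply: (@le_trans _ _ `|(a + c) *: x|).
    by rewrite normrZ x1 mulr1 ler_norm.
  apply: le_trans (ler_normD _ _).
  by rewrite addrACA subrr addr0 -scalerDl addrC.
have supS c : sup S <= `|c *: x + z| - c.
  by apply: ge_sup; [exists (0 - `|0 *: x - z|), 0|move=> _ [a _ <-]; exact: cross].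
have Sle a : a - `|a *: x - z| <= sup S.
  apply: ub_le_sup; last by exists a.
  by exists (`|0 *: x + z| - 0) => _ [c _ <-]; exact: cross.
have mid (c : R) : `|c + sup S| <= `|c *: x + z|.
  rewrite ler_norml; apply/andP; split; last first.
    by have := supS c; rewrite lerBrDr addrC.
  have := Sle (- c); have -> : - c *: x - z = - (c *: x + z).
    by rewrite opprD scaleNr.
  by rewrite normrN; lra.
exists (sup S) => a b; have [->|b0] := eqVneq b 0.
  by rewrite mul0r scale0r !addr0 normrZ x1 mulr1.
have -> : a + b * sup S = b * (a / b + sup S) by field.
have -> : a *: x + b *: z = b *: ((a / b) *: x + z).
  by rewrite scalerDr scalerA mulrC divfK.
by rewrite normrM normrZ ler_wpM2l.
Qed.

(** The norm-one functional sending [x] to 1 and [z] to [s] vanishes at [z - s *: x]; [w] is that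
    vector normalised. The last clause is Birkhoff-James orthogonality of [x] to [w]. *)
Lemma support_basis x : has_dimension V 2 -> `|x| = 1 ->
  exists w, [/\ `|w| = 1, is_basis2 x w &
                forall a b : R, `|a| <= `|a *: x + b *: w|].
Proof.
move=> V2 x1; have x0 : x != 0 by rewrite -normr_gt0 x1.
have [z xz] := extend_basis2 V2 x0.
have [s sP] := unit_functional_extension z x1.
have w0 : z - s *: x != 0.
  apply/eqP => zsx; have [] := xz.2 (- s) 1.
    by rewrite scaleNr scale1r addrC.
  by move=> _ /eqP; rewrite oner_eq0.
have nw : 0 < `|z - s *: x| by rewrite normr_gt0.
exists (`|z - s *: x|^-1 *: (z - s *: x)); split.
- by rewrite normrZ normfV normr_id mulVf ?gt_eqF.
- by apply: is_basis2_shift => //; rewrite invr_eq0 gt_eqF.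
- move=> a b; rewrite scalerA; set c := b / _.
  have := sP (a - c * s) c; rewrite subrK; congr (_ <= `|_|).
  by rewrite scalerBr scalerBl scalerA addrAC addrA.
Qed.

Lemma continuous_norm_affine (u : V) (b : R) (y w : V) :
  continuous (fun pq : R * R => `|u + b *: (pq.1 *: y + pq.2 *: w)| : R).
Proof.
move=> pq; apply: cvg_norm; apply: cvgD; first exact: cvg_cst.
apply: cvgZl_tmp; apply: cvgD; apply: cvgZr_tmp.
  exact: cvg_fst.
exact: cvg_snd.
Qed.

End TwoDimensional.

(** * Transitivity of the isometries under the L-P property *)

Section Transitivity.
Context {R : realType} {V : normedModType R}.
Hypotheses (V2 : has_dimension V 2) (scV : strictly_convex V).
Hypothesis LP : LP_property V V.
Implicit Types x y z w v : V.

(** Unit vectors are extreme, L-P keeps their images extreme, and extreme points have norm 1. *)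
Lemma extreme_contraction_isometry (T : V -> V) : opnorm T = 1 ->
  extreme_contraction T -> forall v, `|T v| = `|v|.
Proof.
move=> T1 eT; have [[bT _] _] := eT; have [lT _] := bT.
have TE := (LP bT T1).1 eT => v.
have [->|v0] := eqVneq v 0.
  by rewrite -(scale0r 0) linearZ_fun// !scale0r normr0.
have nv : 0 < `|v| by rewrite normr_gt0.
have vE : v = `|v| *: (`|v|^-1 *: v) by rewrite scalerA mulfV ?gt_eqF// scale1r.
have u1 : `|T (`|v|^-1 *: v)| = 1.
  apply: (extreme_point_unit v0); apply: TE; exists (`|v|^-1 *: v) => //.
  by apply: scV; rewrite /unit_sphere /= normrZ normfV normr_id mulVf ?gt_eqF.
by rewrite {1}vE linearZ_fun// normrZ normr_id u1 mulr1.
Qed.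

Lemma isometry_transitive x y : `|x| = 1 -> `|y| = 1 ->
  exists T : V -> V, [/\ linear T, T x = y & forall v, `|T v| = `|v|].
Proof.
move=> x1 y1.
have [z [z1 xz xzN]] := support_basis V2 x1.
have [w [w1 yw ywN]] := support_basis V2 y1.
have [f [g [fgE fE gE flin glin]]] := is_basis2_coord xz.
pose vec (k : R * R) := k.1 *: y + k.2 *: w.
(* The face in coordinates: [k] is in [K] when [x |-> y], [z |-> vec k] defines a contraction. The
   rank-one map with [z |-> 0] is one, by the support property of [z]. *)
pose K := [set k : R * R | forall a b, `|a *: y + b *: vec k| <= `|a *: x + b *: z|].
have K0 : K (0, 0).
  by move=> a b; rewrite /vec /= !scale0r addr0 scaler0 addr0 normrZ y1 mulr1.
have clK : closed K.
  have -> : K = \bigcap_(ab in [set: R * R])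
      ((fun k => `|ab.1 *: y + ab.2 *: vec k|) @^-1`
        [set r | r <= `|ab.1 *: x + ab.2 *: z|]).
    apply/seteqP; split=> [k Kk [a b] _|k Kk a b]; first exact: Kk.
    exact: (Kk (a, b)).
  apply: closed_bigI => -[a b] _.
  have /continuous_closedP := @continuous_norm_affine _ _ (a *: y) b y w.
  by apply; exact: closed_le.
(* The support property of [w] bounds [p] by 1; then [q *: w], the difference of [vec k] and
   [p *: y], has norm at most 2. *)
have KC : K `<=` `[-1, 1]%classic `*` `[-2, 2]%classic.
  move=> [p q] /(_ 0 1); rewrite /vec /= !scale0r !scale1r !add0r z1 => k1.
  have p1 : `|p| <= 1 by exact: le_trans (ywN p q) k1.
  have q2 : `|q| <= 2.
    have -> : `|q| = `|(p *: y + q *: w) - p *: y|.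
      by rewrite addrAC subrr add0r normrZ w1 mulr1.
    apply: le_trans (ler_normB _ _) _.
    by rewrite normrZ y1 mulr1 (natrD _ 1 1) lerD.
  by split; rewrite /= in_itv /= -ler_norml.
(* A strictly convex function on the convex set [K] is maximal only at extreme points of [K], so its
   maximiser [c] is one. *)
pose N (k : R * R) : R := k.1 * k.1 + k.2 * k.2.
have cN : continuous N.
  move=> k; apply: cvgD; apply: cvgM; try exact: cvg_fst; exact: cvg_snd.
have [||c Kc cmax] := compact_maximizer _ clK _ KC cN.
- by exists (0, 0).
- by apply: compact_setX; exact: segment_compact.
pose T v := f v *: y + g v *: vec c.
have lT : linear T.
  move=> a u v; have := flin a 1 u v; have := glin a 1 u v.
  rewrite scale1r !mul1r /T => -> ->.
  by rewrite !scalerDl addrACA -!scalerA -scalerDr.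
have Tx : T x = y.
  have := fE 1 0; have := gE 1 0.
  by rewrite /T scale1r scale0r addr0 => -> ->; rewrite scale1r scale0r addr0.
have T1 v : `|T v| <= `|v| by rewrite [in leRHS](fgE v); exact: Kc.
have uT := contraction_unit_ball lT T1.
have oT : opnorm T = 1.
  apply/eqP; rewrite eq_le uT.2 -[leLHS]y1 -[in leLHS]Tx.
  by apply: opnorm_ge; rewrite ?x1//; case: uT.
exists T; split=> //; apply: extreme_contraction_isometry => //.
split=> // A B t uA uB t01 TAB.
have TABv v : T v = (1 - t) *: A v + t *: B v by rewrite TAB.
have [[lA _] _] := uA; have [[lB _] _] := uB.
have A1 v : `|A v| <= `|v| by case: uA => ? ?; exact: opnorm_le1.
have B1 v : `|B v| <= `|v| by case: uB => ? ?; exact: opnorm_le1.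
(* The unit vector [y] is extreme, so [A] and [B] belong to the same face as [T]. *)
have [Ax Bx] : A x = y /\ B x = y.
  have [_] := scV y1.
  apply; [| |exact: t01|by rewrite -TABv].
  - by rewrite /unit_ball /= (le_trans (A1 _))// x1.
  - by rewrite /unit_ball /= (le_trans (B1 _))// x1.
have [pA [qA Az]] := yw.1 (A z); have [pB [qB Bz]] := yw.1 (B z).
have KA : K (pA, qA).
  by move=> a b; rewrite /vec /= -Az -Ax -linear_comb2//; exact: A1.
have KB : K (pB, qB).
  by move=> a b; rewrite /vec /= -Bz -Bx -linear_comb2//; exact: B1.
have Tz : T z = vec c.
  have := fE 0 1; have := gE 0 1.
  by rewrite /T scale1r scale0r add0r => -> ->; rewrite scale1r scale0r add0r.
have [c1 c2] : c.1 = (1 - t) * pA + t * pB /\ c.2 = (1 - t) * qA + t * qB.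
  apply: (is_basis2_inj yw); rewrite -scaler_comb2 -Az -Bz -TABv Tz.
  by [].
have NA := cmax _ KA; have NB := cmax _ KB.
have [t0 t1] := andP t01.
(* Strict convexity of [N] in exact form: [t (1 - t)] times this sum is the weighted mean of [N] at
   the two points minus [N c], which maximality makes nonpositive. *)
have /eqP : (pA - pB) ^+ 2 + (qA - qB) ^+ 2 = 0.
  apply/eqP; rewrite eq_le addr_ge0 ?sqr_ge0// andbT.
  have t10 : 0 < t * (1 - t) by rewrite mulr_gt0// subr_gt0.
  rewrite -(pmulr_rle0 _ t10).
  have -> : t * (1 - t) * ((pA - pB) ^+ 2 + (qA - qB) ^+ 2) =
      (1 - t) * (N (pA, qA) - N c) + t * (N (pB, qB) - N c).
    by rewrite /N /= c1 c2; ring.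
  rewrite -oppr_ge0 opprD -!mulrN !opprB addr_ge0// mulr_ge0 ?subr_ge0//.
    exact: ltW.
  exact: ltW.
rewrite paddr_eq0 ?sqr_ge0// !sqrf_eq0 !subr_eq0 => /andP[/eqP pAB /eqP qAB].
have ABz : A z = T z /\ B z = T z.
  rewrite Az Bz Tz /vec c1 c2 pAB qAB.
  have tE r : (1 - t) * r + t * r = r by ring.
  by rewrite !tE.
split; apply: funext => v; rewrite (fgE v) (linear_comb2 lT).
  by rewrite (linear_comb2 lA) Ax ABz.1 Tx.
by rewrite (linear_comb2 lB) Bx ABz.2 Tx.
Qed.

End Transitivity.

(** * Quadratic forms below the squared norm, and concavity of the determinant *)

Section LoewnerForm.
Context {R : realType} {V : normedModType R}.
Implicit Types x y z w v : V.

Definition qform (a b c s t : R) : R := a * s ^+ 2 + 2 * b * s * t + c * t ^+ 2.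

(** A triple [(a, b, c)] encodes the symmetric matrix with rows [a, b] and [b, c]. The lower bound 0
    makes the set bounded and excludes negative definite forms, whose determinant is also
    positive. *)
Definition dominated x w : set (R * R * R) :=
  [set k | forall s t, 0 <= qform k.1.1 k.1.2 k.2 s t <= `|s *: x + t *: w| ^+ 2].

Lemma closed_dominated x w : closed (dominated x w).
Proof.
have -> : dominated x w = \bigcap_(st in [set: R * R])
    ((fun k : R * R * R => qform k.1.1 k.1.2 k.2 st.1 st.2) @^-1`
      ([set r | 0 <= r] `&` [set r | r <= `|st.1 *: x + st.2 *: w| ^+ 2])).
  apply/seteqP; split=> [k Dk [s t] _|k Dk s t].
    by split; case/andP: (Dk s t).
  by apply/andP; have [] := Dk (s, t) I.
apply: closed_bigI => -[s t] _ /=.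
have cq : continuous (fun k : R * R * R => qform k.1.1 k.1.2 k.2 s t).
  move=> k; have c1 : k0.1 @[k0 --> k] --> k.1 by exact: cvg_fst.
  have c11 : k0.1.1 @[k0 --> k] --> k.1.1.
    exact: (cvg_comp _ _ c1 cvg_fst).
  have c12 : k0.1.2 @[k0 --> k] --> k.1.2.
    exact: (cvg_comp _ _ c1 cvg_snd).
  have c2 : k0.2 @[k0 --> k] --> k.2 by exact: cvg_snd.
  apply: cvgD; first apply: cvgD.
  - by apply: cvgM c11 _; exact: cvg_cst.
  - apply: cvgM; last exact: cvg_cst.
    apply: cvgM; last exact: cvg_cst.
    by apply: cvgM c12; exact: cvg_cst.
  - by apply: cvgM c2 _; exact: cvg_cst.
have /continuous_closedP := cq; apply.
by apply: closedI; [exact: closed_ge|exact: closed_le].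
Qed.

(** The values at [(1, 0)] and [(0, 1)] bound [a] and [c]; positivity at [(1, 1)] and [(1, -1)]
    bounds [2 |b|] by [a + c]. *)
Lemma dominated_bounded x w : dominated x w `<=`
  (`[- (`|x| ^+ 2), `|x| ^+ 2] `*` `[- (`|x| ^+ 2 + `|w| ^+ 2), `|x| ^+ 2 + `|w| ^+ 2])
   `*` `[- (`|w| ^+ 2), `|w| ^+ 2].
Proof.
move=> [[a b] c] D.
have := D 1 0; have := D 0 1; have := D 1 1; have := D 1 (-1).
rewrite /qform /= !scale1r !scale0r addr0 add0r => /andP[+ _] /andP[+ _].
move=> ? ? /andP[? ?] /andP[? ?].
by split; [split|]; rewrite /= in_itv /=; apply/andP; split; lra.
Qed.

(* Multiplied by a1 a2, the mixed term of the determinant of the sum becomes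
   2 m a1 a2 plus a sum of squares. *)
Lemma det_strict_concave (m a1 b1 c1 a2 b2 c2 : R) :
  0 < m -> 0 <= a1 -> 0 <= a2 -> a1 * c1 - b1 ^+ 2 = m -> a2 * c2 - b2 ^+ 2 = m ->
  ((a1 + a2) / 2) * ((c1 + c2) / 2) - ((b1 + b2) / 2) ^+ 2 <= m ->
  [/\ a1 = a2, b1 = b2 & c1 = c2].
Proof.
move=> m0 a10 a20 d1 d2 dle.
have pos (a b c : R) : 0 <= a -> a * c - b ^+ 2 = m -> 0 < a.
  move=> a0 d; rewrite lt_neqAle a0 andbT eq_sym; apply/eqP => aE.
  by have := sqr_ge0 b; rewrite aE mul0r in d; lra.
have {}a10 := pos _ _ _ a10 d1; have {}a20 := pos _ _ _ a20 d2.
have sumle : a1 * c2 + a2 * c1 - 2 * b1 * b2 <= 2 * m.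
  have -> : a1 * c2 + a2 * c1 - 2 * b1 * b2 =
    4 * (((a1 + a2) / 2) * ((c1 + c2) / 2) - ((b1 + b2) / 2) ^+ 2)
      - (a1 * c1 - b1 ^+ 2) - (a2 * c2 - b2 ^+ 2) by field.
  by rewrite d1 d2; lra.
have aa0 : 0 < a1 * a2 by rewrite mulr_gt0.
have key : m * (a1 - a2) ^+ 2 + (a1 * b2 - a2 * b1) ^+ 2 <= 0.
  have -> : m * (a1 - a2) ^+ 2 + (a1 * b2 - a2 * b1) ^+ 2 =
    a1 * a2 * (a1 * c2 + a2 * c1 - 2 * b1 * b2 - 2 * m)
    - a1 ^+ 2 * (a2 * c2 - b2 ^+ 2 - m) - a2 ^+ 2 * (a1 * c1 - b1 ^+ 2 - m) by ring.
  by rewrite d1 d2 subrr !mulr0 !subr0 pmulr_rle0// subr_le0.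
have sa : 0 <= m * (a1 - a2) ^+ 2 by rewrite mulr_ge0 ?sqr_ge0// ltW.
have sb := sqr_ge0 (a1 * b2 - a2 * b1).
have : m * (a1 - a2) ^+ 2 + (a1 * b2 - a2 * b1) ^+ 2 == 0.
  by rewrite eq_le key addr_ge0.
rewrite paddr_eq0// mulf_eq0 (gt_eqF m0) /= !sqrf_eq0.
rewrite subr_eq0 => /andP[/eqP aE]; rewrite aE -mulrBr mulf_eq0 (gt_eqF a20) /=.
rewrite subr_eq0 => /eqP bE; split=> //.
by apply: (mulfI (lt0r_neq0 a20)); move: d1; rewrite aE -bE; lra.
Qed.

End LoewnerForm.

(** * Invariance of the maximal form, and the norm as a quadratic form *)

Section QuadraticNorm.
Context {R : realType} {V : normedModType R}.
Implicit Types x y z w v : V.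

(* The coefficients of the form (a, b, c) composed with the matrix (p, q; r, s). *)
Definition pulled (a b c p q r s : R) : R * R * R :=
  (qform a b c p r, a * p * q + b * (p * s + q * r) + c * r * s, qform a b c q s).

Definition det_form (k : R * R * R) : R := k.1.1 * k.2 - k.1.2 ^+ 2.

(** Isometries enter as matrices in the basis [x, w], with columns [(p, r)] and [(q, s)], so that
    pulling back a form is a polynomial identity. *)
Definition isometric_matrix x w (p q r s : R) : Prop :=
  forall i j, `|(p * i + q * j) *: x + (r * i + s * j) *: w| = `|i *: x + j *: w|.

Lemma dominated_pulled x w a b c p q r s : isometric_matrix x w p q r s ->
  dominated x w (a, b, c) -> dominated x w (pulled a b c p q r s).
Proof.
move=> iso D i j; rewrite -iso.
have -> : qform (pulled a b c p q r s).1.1 (pulled a b c p q r s).1.2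
    (pulled a b c p q r s).2 i j = qform a b c (p * i + q * j) (r * i + s * j).
  by rewrite /pulled /qform /=; ring.
exact: D.
Qed.

Lemma isometric_matrix_inv x w p q r s : is_basis2 x w ->
  isometric_matrix x w p q r s ->
  p * s - q * r != 0 /\
  isometric_matrix x w (s / (p * s - q * r)) (- q / (p * s - q * r))
                       (- r / (p * s - q * r)) (p / (p * s - q * r)).
Proof.
move=> xw iso; have d0 : p * s - q * r != 0.
  apply/eqP => d0.
  have ker i j : p * i + q * j = 0 -> r * i + s * j = 0 -> i = 0 /\ j = 0.
    move=> e1 e2; apply: xw.2; apply/eqP; rewrite -normr_eq0 -iso e1 e2.
    by rewrite !scale0r addr0 normr0.
  (* If the determinant vanishes, [(s, -r)] and [(q, -p)] lie in the kernel; injectivity then makes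
     the whole matrix zero, which kills [(1, 1)]. *)
  have [||s0 /eqP] := ker s (- r); [by rewrite mulrN|by ring|].
  rewrite oppr_eq0 => /eqP r0.
  have [||q0 p0] := ker q (- p); [by ring|by rewrite s0 r0; ring|].
  have [||/eqP] := ker 1 1.
  - by move/eqP: p0; rewrite oppr_eq0 q0 => /eqP ->; ring.
  - by rewrite r0 s0; ring.
  by rewrite oner_eq0.
split=> // i j; rewrite -iso; congr `|_ *: _ + _ *: _|; by field.
Qed.

Lemma dominated_max x w : `|x| = 1 -> `|w| = 1 ->
  (forall a b : R, `|a| <= `|a *: x + b *: w|) ->
  exists k, [/\ dominated x w k, 0 < det_form k &
                forall l, dominated x w l -> det_form l <= det_form k].
Proof.
move=> x1 w1 xwN.
(* With [n] the norm of [s *: x + t *: w], one has [|s| <= n] and [|t| <= 2 n], so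
   [s^2 / 2 + t^2 / 8 <= n^2]. This form has determinant 1/16, so the maximum is positive. *)
have D0 : dominated x w (2^-1, 0, 8^-1).
  move=> s t; rewrite /qform /=; have ss := sqr_ge0 s; have tt := sqr_ge0 t.
  apply/andP; split; first by lra.
  have N0 := normr_ge0 (s *: x + t *: w); have sN := xwN s t.
  have tN : `|t| <= 2 * `|s *: x + t *: w|.
    have -> : `|t| = `|(s *: x + t *: w) - s *: x|.
      by rewrite addrAC subrr add0r normrZ w1 mulr1.
    apply: le_trans (ler_normB _ _) _.
    by rewrite normrZ x1 mulr1 mulr2n mulrDl mul1r lerD2l.
  have sN2 : s ^+ 2 <= `|s *: x + t *: w| ^+ 2.
    by rewrite -(real_normK (num_real s)) ler_sqr.
  have tN2 : t ^+ 2 <= (2 * `|s *: x + t *: w|) ^+ 2.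
    by rewrite -(real_normK (num_real t)) ler_sqr// nnegrE mulr_ge0.
  by rewrite exprMn in tN2; lra.
have cdet : continuous det_form.
  move=> k; have c1 : k0.1 @[k0 --> k] --> k.1 by exact: cvg_fst.
  have c11 : k0.1.1 @[k0 --> k] --> k.1.1 by exact: (cvg_comp _ _ c1 cvg_fst).
  have c12 : k0.1.2 @[k0 --> k] --> k.1.2 by exact: (cvg_comp _ _ c1 cvg_snd).
  by apply: cvgB; [apply: cvgM c11 _; exact: cvg_snd|apply: cvgM].
have [||k Dk kmax] :=
  compact_maximizer _ (@closed_dominated _ _ x w) _ (@dominated_bounded _ _ x w) cdet.
- by exists (2^-1, 0, 8^-1).
- by apply: compact_setX; [apply: compact_setX|]; exact: segment_compact.
exists k; split=> //; apply: lt_le_trans (kmax _ D0).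
by rewrite /det_form /=; lra.
Qed.

(** Pulling back multiplies the determinant by [(p s - q r)^2]. Maximality bounds this factor by 1
    for the matrix and its inverse, so it equals 1 and the pulled form is a second maximiser. The
    midpoint of the two is again dominated, and strict concavity identifies them. *)
Lemma max_form_invariant x w k p q r s : is_basis2 x w ->
  dominated x w k -> 0 < det_form k ->
  (forall l, dominated x w l -> det_form l <= det_form k) ->
  isometric_matrix x w p q r s ->
  qform k.1.1 k.1.2 k.2 p r = k.1.1.
Proof.
case: k => [[a b] c] /= xw D m0 kmax iso.
have pdet p' q' r' s' : det_form (pulled a b c p' q' r' s') =
    (p' * s' - q' * r') ^+ 2 * det_form (a, b, c).
  by rewrite /det_form /pulled /qform /=; ring.
have dle p' q' r' s' : isometric_matrix x w p' q' r' s' ->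
    (p' * s' - q' * r') ^+ 2 <= 1.
  move=> /dominated_pulled/(_ D)/kmax; rewrite pdet.
  by rewrite -ler_pdivlMr// divff ?gt_eqF.
have [d0 iso'] := isometric_matrix_inv xw iso.
have d1 : (p * s - q * r) ^+ 2 = 1.
  apply/eqP; rewrite eq_le dle//=; have := dle _ _ _ _ iso'.
  set d := p * s - q * r in d0 *.
  have -> : s / d * (p / d) - - q / d * (- r / d) = d^-1.
    by rewrite /d; field.
  by rewrite exprVn invf_le1// exprn_even_gt0.
have D' := dominated_pulled iso D.
have a0 : 0 <= a by have /andP[+ _] := D 1 0; rewrite /qform /=; lra.
have a0' : 0 <= qform a b c p r.
  by have /andP[+ _] := D' 1 0; rewrite {1}/qform /=; lra.
have [| |aE _ _] := @det_strict_concave R _ a b c (qform a b c p r)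
    (a * p * q + b * (p * s + q * r) + c * r * s) (qform a b c q s)
    m0 a0 a0' erefl.
- by have := pdet p q r s; rewrite d1 mul1r.
- apply: (kmax ((a + qform a b c p r) / 2,
     (b + (a * p * q + b * (p * s + q * r) + c * r * s)) / 2,
     (c + qform a b c q s) / 2)) => i j.
  have /andP[D1 D2] := D i j; have /andP[D1' D2'] := D' i j.
  set N := `|_| ^+ 2 in D2 D2' *.
  have -> : qform ((a + qform a b c p r) / 2)
      ((b + (a * p * q + b * (p * s + q * r) + c * r * s)) / 2)
      ((c + qform a b c q s) / 2) i j =
    (qform a b c i j + qform (qform a b c p r)
      (a * p * q + b * (p * s + q * r) + c * r * s) (qform a b c q s) i j) / 2.
    by rewrite /qform; field.
  by move: D1 D1' D2 D2' => /=; set q1 := qform a b c i j; set q2 := qform _ _ _ i j; lra.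
- exact/esym.
Qed.

(** By transitivity each unit vector is the first column of an isometric matrix, so the maximal form
    takes on the whole sphere its value [a] at [x]. By homogeneity the squared norm is this form
    divided by [a]. *)
Lemma quadratic_norm : has_dimension V 2 ->
  (forall x y : V, `|x| = 1 -> `|y| = 1 ->
    exists T : V -> V, [/\ linear T, T x = y & forall v, `|T v| = `|v|]) ->
  forall u v : V, exists B : R, forall s t : R,
    `|s *: u + t *: v| ^+ 2 = s ^+ 2 * `|u| ^+ 2 + 2 * B * s * t + t ^+ 2 * `|v| ^+ 2.
Proof.
move=> V2 trans.
have [x x1] : exists x : V, `|x| = 1.
  have [e [e' /is_basis2_neq0 e0]] := has_dimension2P.1 V2.
  exists (`|e|^-1 *: e).
  by rewrite normrZ normfV normr_id mulVf// normr_eq0.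
have [w [w1 xw xwN]] := support_basis V2 x1.
have [[[a b] c] [D m0 kmax]] := dominated_max x1 w1 xwN.
have a0 : 0 < a.
  have /andP[+ _] := D 1 0; rewrite /qform /= => a0.
  rewrite lt_neqAle eq_sym; apply/andP; split; last by lra.
  apply/eqP => aE; move: m0; rewrite /det_form /= aE mul0r sub0r oppr_gt0.
  by rewrite ltNge sqr_ge0.
have sphere s t : `|s *: x + t *: w| = 1 -> qform a b c s t = a.
  move=> st1; have [T [lT Tx TN]] := trans _ _ x1 st1.
  have [q [q' Tw]] := xw.1 (T w).
  apply: (max_form_invariant xw D m0 kmax (q := q) (s := q')) => i j.
  rewrite -[RHS]TN (linear_comb2 lT) Tx Tw scaler_comb2.
  by congr `|_ *: _ + _ *: _|; ring.
have normE s t : `|s *: x + t *: w| ^+ 2 = qform a b c s t / a.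
  have [st0|st0] := eqVneq (s *: x + t *: w) 0.
    have [-> ->] := xw.2 _ _ st0.
    by rewrite !scale0r addr0 normr0 /qform; field; rewrite gt_eqF.
  have n0 : `|s *: x + t *: w| != 0 by rewrite normr_eq0.
  set n := `|_| in n0 *; have := sphere (s / n) (t / n).
  rewrite ![_ / n]mulrC -!scalerA -scalerDr normrZ normfV normr_id mulVf//.
  move=> /(_ erefl); rewrite /qform => qE.
  apply: (mulIf (lt0r_neq0 a0)); rewrite divfK ?gt_eqF// -[in LHS]qE.
  by field.
move=> u v; have [u1 [u2 ->]] := xw.1 u; have [v1 [v2 ->]] := xw.1 v.
(* The polar form of the maximal form at [u, v], divided by [a]. *)
exists ((a * u1 * v1 + b * (u1 * v2 + u2 * v1) + c * u2 * v2) / a) => s t.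
by rewrite scaler_comb2 !normE /qform; field; rewrite gt_eqF.
Qed.

End QuadraticNorm.

(** * Extreme contractions of a Euclidean plane *)

Lemma rank_one_form (R : realType) (p q b : R) : 0 <= p -> 0 <= q -> p * q = b ^+ 2 ->
  exists l m : R, [/\ l ^+ 2 = p, m ^+ 2 = q & l * m = b].
Proof.
move=> p0 q0 pq.
have [pE|p_neq0] := eqVneq p 0.
  exists 0, (Num.sqrt q); rewrite expr0n sqr_sqrtr// mul0r; split=> //.
  by apply/esym/eqP; rewrite -sqrf_eq0 -pq pE mul0r.
have sp : Num.sqrt p != 0 by rewrite sqrtr_eq0 -ltNge lt_neqAle eq_sym p_neq0.
exists (Num.sqrt p), (b / Num.sqrt p); split; first by rewrite sqr_sqrtr.
  by rewrite expr_div_n sqr_sqrtr// -pq mulrAC divff// mul1r.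
by rewrite mulrC divfK.
Qed.

Section Euclidean.
Context {R : realType} {V : normedModType R} (ip : V -> V -> R).
Hypothesis V2 : has_dimension V 2.
Hypothesis ipC : forall u v, ip u v = ip v u.
Hypothesis ipl : forall (a b : R) u v w, ip (a *: u + b *: v) w = a * ip u w + b * ip v w.
Hypothesis ipN : forall v, `|v| ^+ 2 = ip v v.

Let ipr (a b : R) u v w : ip w (a *: u + b *: v) = a * ip w u + b * ip w v.
Proof. by rewrite ipC ipl !(ipC _ w). Qed.

Let normD2 (a b : R) u v :
  `|a *: u + b *: v| ^+ 2 = a ^+ 2 * `|u| ^+ 2 + 2 * a * b * ip u v + b ^+ 2 * `|v| ^+ 2.
Proof. by rewrite !ipN ipl !ipr (ipC v u); ring. Qed.

Lemma orthonormal_basis : exists x w,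
  [/\ is_basis2 x w, `|x| = 1, `|w| = 1 & ip x w = 0].
Proof.
have [e [e' ee']] := has_dimension2P.1 V2.
have e0 := is_basis2_neq0 ee'.
pose x := `|e|^-1 *: e.
have x1 : `|x| = 1 by rewrite normrZ normfV normr_id mulVf// normr_eq0.
have x0 : x != 0 by rewrite -normr_gt0 x1.
have [z xz] := extend_basis2 V2 x0.
have xw b : b != 0 -> is_basis2 x (b *: (z - ip z x *: x)).
  by move=> b0; exact: is_basis2_shift.
pose y := z - ip z x *: x.
have y0 : `|y| != 0.
  rewrite normr_eq0; apply: (@is_basis2_neq0 _ _ y x); apply: is_basis2_sym.
  by have := xw 1 (oner_neq0 _); rewrite scale1r.
exists x, (`|y|^-1 *: y); split=> //.
- by apply: xw; rewrite invr_eq0.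
- by rewrite normrZ normfV normr_id mulVf.
have yE : `|y|^-1 *: y = `|y|^-1 *: z + (- (`|y|^-1 * ip z x)) *: x.
  by rewrite {2}/y scalerBr scalerA scaleNr.
by rewrite yE ipr -ipN x1 (ipC x z); ring.
Qed.

Lemma euclidean_extreme_isometry (T : V -> V) : extreme_contraction T ->
  opnorm T = 1 -> forall v, `|T v| = `|v|.
Proof.
move=> [uT extT] oT; have [[lT _] _] := uT.
have T1 v : `|T v| <= `|v| by case: uT => ? ?; exact: opnorm_le1.
have [x [w [xw x1 w1 xw0]]] := orthonormal_basis.
have nE s t : `|s *: x + t *: w| ^+ 2 = s ^+ 2 + t ^+ 2.
  by rewrite normD2 x1 w1 xw0; ring.
(* The coefficients of the defect [|v|^2 - |T v|^2] in the orthonormal basis, [b] entering with a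
   minus sign. *)
pose p := 1 - `|T x| ^+ 2; pose q := 1 - `|T w| ^+ 2; pose b := ip (T x) (T w).
have TE s t : `|T (s *: x + t *: w)| ^+ 2 =
    s ^+ 2 + t ^+ 2 - (p * s ^+ 2 - 2 * b * s * t + q * t ^+ 2).
  by rewrite (linear_comb2 lT) normD2 /p /q /b; ring.
have p1 : p <= 1 by rewrite /p lerBlDr lerDl sqr_ge0.
clearbody p q b.
have h0 s t : 0 <= p * s ^+ 2 - 2 * b * s * t + q * t ^+ 2.
  have : `|T (s *: x + t *: w)| ^+ 2 <= `|s *: x + t *: w| ^+ 2.
    by rewrite ler_sqr ?nnegrE.
  by rewrite TE nE; lra.
have p0 : 0 <= p by have := h0 1 0; lra.
have q0 : 0 <= q by have := h0 0 1; lra.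
(* The defect at [(q, b)] is [q (p q - b^2)]. When [q = 0], its value [p b^2 - 2 b^2] at [(b, 1)] is
   at most [- b^2], since [p <= 1], so [b = 0]. *)
have pqb : 0 <= p * q - b ^+ 2.
  have [qE|q_neq0] := eqVneq q 0.
    have := h0 b 1; rewrite qE mulr0 => bb.
    have b2 := sqr_ge0 b.
    have : p * b ^+ 2 <= b ^+ 2 by rewrite ler_piMl.
    by move: bb; lra.
  have qp : 0 < q by rewrite lt_neqAle eq_sym q_neq0.
  rewrite -(pmulr_rge0 _ qp).
  by have := h0 q b; congr (_ <= _); ring.
have {}pqb : p * q = b ^+ 2.
  apply/eqP; rewrite -subr_eq0 eq_le pqb andbT leNgt; apply/negP => D0.
  have pq0 : 0 < p + q.
    rewrite lt_neqAle addr_ge0// andbT eq_sym paddr_eq0//.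
    apply/negP => /andP[/eqP pE _]; move: D0; rewrite pE mul0r sub0r.
    by rewrite ltNge oppr_le0 sqr_ge0.
  (* Determinant over trace bounds the smallest eigenvalue of the defect from below; by
     Cayley-Hamilton the remainder is a sum of squares over the trace. A positive [d] would force
     [opnorm T < 1]. *)
  pose d := (p * q - b ^+ 2) / (p + q).
  have d0 : 0 < d by exact: divr_gt0.
  have hd s t : d * (s ^+ 2 + t ^+ 2) <= p * s ^+ 2 - 2 * b * s * t + q * t ^+ 2.
    rewrite -subr_ge0.
    have -> : p * s ^+ 2 - 2 * b * s * t + q * t ^+ 2 - d * (s ^+ 2 + t ^+ 2) =
        ((p * s - b * t) ^+ 2 + (b * s - q * t) ^+ 2) / (p + q).
      by rewrite /d; field; rewrite gt_eqF.
    by rewrite divr_ge0 ?addr_ge0 ?sqr_ge0// ltW.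
  have Td v : `|T v| ^+ 2 <= (1 - d) * `|v| ^+ 2.
    have [s [t ->]] := xw.1 v; rewrite TE nE.
    by have := hd s t; lra.
  have d1 : 0 <= 1 - d.
    by have := Td x; rewrite x1 expr1n mulr1; apply: le_trans; exact: sqr_ge0.
  have : opnorm T <= Num.sqrt (1 - d).
    apply: opnorm_le => [|v]; first exact: sqrtr_ge0.
    rewrite -ler_sqr ?nnegrE ?mulr_ge0 ?sqrtr_ge0//.
    by rewrite exprMn sqr_sqrtr.
  rewrite oT -{1}sqrtr1 ler_sqrt; last by lra.
  by lra.
(* The defect, degenerate and nonnegative, is the square of [l s + m t]; hence the sign of [b]. *)
have [l [m [lE mE lm]]] := rank_one_form p0 q0 (etrans pqb (esym (sqrrN b))).
have Tdefect s t : `|T (s *: x + t *: w)| ^+ 2 =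
    `|s *: x + t *: w| ^+ 2 - (l * s + m * t) ^+ 2.
  have bE : b = - (l * m) by rewrite lm opprK.
  by rewrite TE nE -lE -mE bE; ring.
pose e := l ^+ 2 + m ^+ 2.
have [e_eq0|e0] := eqVneq e 0.
  move=> v; have [s [t ->]] := xw.1 v; apply/eqP.
  rewrite -(@eqrXn2 _ 2)//; apply/eqP; rewrite Tdefect.
  move/eqP: e_eq0; rewrite paddr_eq0 ?sqr_ge0// !sqrf_eq0 => /andP[/eqP -> /eqP ->].
  by ring.
have {}e0 : 0 < e by rewrite lt_neqAle eq_sym e0 addr_ge0 ?sqr_ge0.
(* [k] spans the kernel of the linear form [l s + m t], and [y] is a nonzero
   vector orthogonal to [T k]. *)
pose k := (- m) *: x + l *: w.
have [c [d Tk]] := xw.1 (T k); pose y := (- d) *: x + c *: w.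
have Tky : ip (T k) y = 0.
  by rewrite Tk /y ipl !ipr -!ipN x1 w1 (ipC w x) xw0; ring.
(* The defect vanishes at [k], so [T k] is as long as [k], and [y] is [T k] turned by a right
   angle. *)
have y0 : 0 < `|y| ^+ 2.
  have : `|T k| ^+ 2 = e by rewrite Tdefect nE /e; ring.
  by rewrite Tk nE /y nE sqrrN addrC => ->.
(* [n] is orthogonal to [k]. As [T k] is orthogonal to [y], only the [n] component of [v]
   contributes to [ip (T v) y], which is thus [r] times the linear form. *)
pose n := l *: x + m *: w; pose r := ip (T n) y / e.
have Ty s t : ip (T (s *: x + t *: w)) y = r * (l * s + m * t).
  have -> : s *: x + t *: w =
      ((l * s + m * t) / e) *: n + ((l * t - m * s) / e) *: k.
    by rewrite scaler_comb2; congr (_ *: _ + _ *: _); rewrite /e; field;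
       rewrite -/e gt_eqF.
  by rewrite (linear_comb2 lT) ipl Tky /r mulr0 addr0; ring.
have [f [g [fgE fE gE flin glin]]] := is_basis2_coord xw.
pose A (h : R) v := T v + (h * (l * f v + m * g v)) *: y.
have lA h : linear (A h).
  move=> a u v; rewrite /A lT; have := flin a 1 u v; have := glin a 1 u v.
  rewrite scale1r !mul1r => -> ->.
  have -> : h * (l * (a * f u + f v) + m * (a * g u + g v)) =
      a * (h * (l * f u + m * g u)) + h * (l * f v + m * g v) by ring.
  by rewrite scalerDl addrACA -(scalerA a) -scalerDr.
(* All changes to [|T v|^2] are multiples of the squared linear form, so the defect of [T] absorbs
   them under this condition on [h]. *)
have A1 h : 2 * h * r + h ^+ 2 * `|y| ^+ 2 <= 1 -> forall v, `|A h v| <= `|v|.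
  move=> hr v; rewrite -ler_sqr ?nnegrE// (fgE v) /A fE gE.
  set s := f v; set t := g v.
  rewrite -[T _]scale1r normD2 Ty Tdefect -subr_ge0 expr1n !mul1r mulr1.
  set N := `|s *: x + t *: w| ^+ 2.
  have -> : N - (N - (l * s + m * t) ^+ 2
        + 2 * (h * (l * s + m * t)) * (r * (l * s + m * t))
        + (h * (l * s + m * t)) ^+ 2 * `|y| ^+ 2) =
      (l * s + m * t) ^+ 2 * (1 - (2 * h * r + h ^+ 2 * `|y| ^+ 2)) by ring.
  by rewrite mulr_ge0 ?sqr_ge0// subr_ge0.
(* Chosen so that [h (1 + 2 |r| + |y|^2) = 1]; as [h <= 1], the condition of [A1] holds for both [h]
   and [- h]. *)
pose h := (1 + 2 * `|r| + `|y| ^+ 2)^-1.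
have den0 : 0 < 1 + 2 * `|r| + `|y| ^+ 2.
  by have := normr_ge0 r; have := sqr_ge0 `|y|; lra.
have h_gt0 : 0 < h by rewrite invr_gt0.
have hden : h + 2 * h * `|r| + h * `|y| ^+ 2 = 1.
  by rewrite /h; field; rewrite gt_eqF.
have h1 : h <= 1.
  have := mulr_ge0 (ltW h_gt0) (normr_ge0 r).
  by have := mulr_ge0 (ltW h_gt0) (sqr_ge0 `|y|); lra.
have h2 : h ^+ 2 * `|y| ^+ 2 <= h * `|y| ^+ 2.
  by rewrite ler_wpM2r ?sqr_ge0// expr2 ler_piMl// ltW.
have hr1 : h * r <= h * `|r| by rewrite ler_wpM2l ?ler_norm// ltW.
have hr2 : - (h * r) <= h * `|r|.
  by rewrite -mulrN -(normrN r); apply: ler_wpM2l; [exact: ltW|exact: ler_norm].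
have uA : operator_unit_ball (A h).
  by apply: contraction_unit_ball (lA h) _; apply: A1; lra.
have uA' : operator_unit_ball (A (- h)).
  by apply: contraction_unit_ball (lA _) _; apply: A1; rewrite sqrrN; lra.
have half01 : 0 < (2^-1 : R) < 1 by apply/andP; split; lra.
have TA : T = (1 - 2^-1) *: A h + 2^-1 *: A (- h).
  apply: funext => v.
  have -> : (1 - 2^-1 : R) = 2^-1 by field.
  rewrite -scalerDr.
  have -> : (2^-1 *: (A h + A (- h))) v = 2^-1 *: (A h v + A (- h) v) by [].
  rewrite /A mulNr scaleNr addrACA subrr addr0.
  by rewrite -mulr2n -(scaler_nat 2 (T v)) scalerA mulVf ?scale1r// pnatr_eq0.
have [An _] := extT _ _ _ uA uA' half01 TA.
(* At [n] the linear form equals [e > 0], so [A h = T] would give [y = 0]. *)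
have := congr1 (@^~ n) An; rewrite /A fE gE => /(canRL (addKr _)).
rewrite addNr => /eqP; rewrite scaler_eq0 mulf_eq0 (gt_eqF h_gt0) /=.
rewrite -!expr2 -/e (gt_eqF e0) /= => /eqP y_eq0.
by move: y0; rewrite y_eq0 normr0 expr0n ltxx.
Qed.

End Euclidean.

(** * Passage between the planes of [X] and the whole space *)

Section Span2.
Context {R : realType} {X : normedModType R} (x y : X).

Definition span2 : X -> bool :=
  fun v : X => `[< exists a b : R, v = a *: x + b *: y >].

Lemma span2P v : reflect (exists a b : R, v = a *: x + b *: y) (v \in span2).
Proof. exact: asboolP. Qed.

Lemma span2_submod_closed : submod_closed span2.
Proof.
split=> [|a u v /span2P[b [c ->]] /span2P[b' [c' ->]]].
  by apply/span2P; exists 0, 0; rewrite !scale0r addr0.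
apply/span2P; exists (a * b + 1 * b'), (a * c + 1 * c').
by rewrite -scaler_comb2 scale1r.
Qed.

End Span2.

Lemma subspace_strictly_convex (R : realType) (X : normedModType R)
    (Y : submodClosed X) : strictly_convex X -> strictly_convex (subspace_of Y).
Proof.
move=> scX v v1; split=> [|u w t u1 w1 t01 vE].
  by rewrite /unit_ball /= -[leRHS]v1.
have [_] := scX (val v) v1.
move=> /(_ (val u) (val w) t u1 w1 t01)[|uv wv].
  by rewrite vE linearD !linearZ.
by split; apply: val_inj.
Qed.

(** An extreme contraction of norm 1 is an isometry, so it keeps unit vectors on the sphere, where
    all points are extreme; the converse uses strict convexity alone. *)
Lemma hilbert_LP (R : realType) (X : completeNormedModType R) :
  strictly_convex X -> is_hilbert X ->
  forall Y : submodClosed X, has_dimension (subspace_of Y) 2 ->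
  LP_property (subspace_of Y) (subspace_of Y).
Proof.
move=> scX [dot dotN] Y Y2 T bT oT.
have scY := subspace_strictly_convex (Y := Y) scX.
split; last exact: isometry_extreme_contraction.
move=> eT.
pose ip (u v : subspace_of Y) : R := dot (val u) (val v).
have ipC u v : ip u v = ip v u.
  by rewrite /ip; have := @hermC _ _ _ _ dot (val u) (val v); rewrite expr0 mul1r.
have ipl (a b : R) u v w : ip (a *: u + b *: v) w = a * ip u w + b * ip v w.
  by rewrite /ip linearD !linearZ linearDl !linearZl_LR.
have ipN v : `|v| ^+ 2 = ip v v.
  rewrite -[`|v|]/(`|val v|) dotN sqr_sqrtr//.
  have [->|v0] := eqVneq (val v) 0; first by rewrite linear0l.
  by rewrite ltW// neq0_dnorm_gt0.
have Tiso := euclidean_extreme_isometry Y2 ipC ipl ipN eT oT.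
move=> _ [v vE <-]; apply: scY; rewrite /unit_sphere /= Tiso.
have [e [e' /is_basis2_neq0 e0]] := has_dimension2P.1 Y2.
exact: (extreme_point_unit e0).
Qed.

Lemma LP_quadratic_norm (R : realType) (X : completeNormedModType R) :
  strictly_convex X ->
  (forall Y : submodClosed X, has_dimension (subspace_of Y) 2 ->
    LP_property (subspace_of Y) (subspace_of Y)) ->
  forall u v : X, exists B : R, forall s t : R,
    `|s *: u + t *: v| ^+ 2 = s ^+ 2 * `|u| ^+ 2 + 2 * B * s * t + t ^+ 2 * `|v| ^+ 2.
Proof.
move=> scX LP u v.
(* Dependent vectors span no plane; there the formula is computed directly from [u] being a multiple
   of [v]. *)
have [[a [b [ab0 ab]]]|ind] := pselect (exists a b : R,
    (a != 0 \/ b != 0) /\ a *: u + b *: v = 0).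
  wlog a0 : u v a b ab0 ab / a != 0 => [H|].
    case: (ab0) => [a0|b0]; first exact: (H _ _ _ _ ab0 ab a0).
    have [||B BE] := H v u b a _ _ b0; [by left|by rewrite addrC|].
    by exists B => s t; rewrite addrC BE; ring.
  have -> : u = (- (b / a)) *: v.
    apply: (scalerI a0); rewrite scalerA mulrN mulrCA divff// mulr1 scaleNr.
    by apply/eqP; rewrite -subr_eq0 opprK ab.
  exists (- (b / a) * `|v| ^+ 2) => s t.
  rewrite scalerA -scalerDl !normrZ !exprMn !real_normK ?num_real//.
  by ring.
pose Y : submodClosed X := HB.pack (span2 u v)
  (GRing.isSubmodClosed.Build R X (span2 u v)
    (GRing.submod_closed_semi (span2_submod_closed u v))).
have uY : u \in Y by apply/span2P; exists 1, 0; rewrite scale1r scale0r addr0.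
have vY : v \in Y by apply/span2P; exists 0, 1; rewrite scale1r scale0r add0r.
pose u' : subspace_of Y := SubspaceOf uY.
pose v' : subspace_of Y := SubspaceOf vY.
have Y2 : has_dimension (subspace_of Y) 2.
  apply/has_dimension2P; exists u', v'; split=> [w|a b ab0].
    have /span2P[a [b wE]] := valP w; exists a, b; apply: val_inj.
    by rewrite linearD !linearZ.
  have {}ab0 : a *: u + b *: v = 0.
    by have := congr1 val ab0; rewrite linearD !linearZ linear0.
  have [a0|a0] := eqVneq a 0; have [b0|b0] := eqVneq b 0 => //;
    by case: ind; exists a, b; split=> //; first [by left | by right].
have scY := subspace_strictly_convex (Y := Y) scX.
have [B BE] := quadratic_norm Y2 (isometry_transitive Y2 scY (LP _ Y2)) u' v'.
exists B => s t; have := BE s t.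
by rewrite -[`|_ + _|]/(`|val _|) linearD !linearZ.
Qed.

(** Polarisation [D] of the squared norm is the inner product: the parallelogram law gives
    additivity, the expansion in [s, t] gives homogeneity. *)
Lemma quadratic_norm_hilbert (R : realType) (X : completeNormedModType R) :
  (forall u v : X, exists B : R, forall s t : R,
    `|s *: u + t *: v| ^+ 2 = s ^+ 2 * `|u| ^+ 2 + 2 * B * s * t + t ^+ 2 * `|v| ^+ 2) ->
  is_hilbert X.
Proof.
move=> H; pose N (v : X) : R := `|v| ^+ 2.
pose D (u v : X) : R := (N (u + v) - N u - N v) / 2.
have ND u v (s t : R) :
    N (s *: u + t *: v) = s ^+ 2 * N u + 2 * D u v * s * t + t ^+ 2 * N v.
  have [B BE] := H u v.
  have := BE 1 1; rewrite !scale1r -!/(N _) => B1.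
  by rewrite /N BE -!/(N _) /D B1; field.
have par u v : N (u + v) + N (u - v) = 2 * N u + 2 * N v.
  have := ND u v 1 1; have := ND u v 1 (-1).
  by rewrite scaleN1r !scale1r => -> ->; ring.
have DC u v : D u v = D v u by rewrite /D (addrC u) addrAC.
(* The first two parallelogram identities minus the third isolate [N (u + v + w)]; the fourth
   eliminates [N (u - v)]. *)
have DD u v w : D (u + v) w = D u w + D v w.
  have e1 := par (u + w) v; have e2 := par (v + w) u.
  have e3 := par w (u - v); have e4 := par u v.
  have s1 : u + w + v = u + v + w by rewrite addrAC.
  have s2 : v + w + u = u + v + w by rewrite addrC addrA.
  have s3 : w + (u - v) = u + w - v by rewrite addrCA addrA.
  have s4 : w - (u - v) = v + w - u by rewrite opprB addrC addrAC.
  rewrite s1 in e1; rewrite s2 in e2; rewrite s3 s4 in e3.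
  by rewrite /D; lra.
(* The expansion of [N (a *: u + w)] gives all real [a] at once. *)
have DZ a u w : D (a *: u) w = a * D u w.
  have := ND u w a 1; rewrite {2}/D => E.
  rewrite /D -[w in N (_ + w)]scale1r E.
  have -> : N (a *: u) = a ^+ 2 * N u.
    by rewrite /N normrZ exprMn real_normK ?num_real.
  by rewrite /D; field.
have D0 u : D u u = N u.
  rewrite /D -mulr2n -scaler_nat.
  have -> : N (2 *: u) = 4 * N u.
    by rewrite /N normrZ exprMn real_normK ?num_real//; congr (_ * _); ring.
  by field.
have DN u v : D (- u) v = - D u v by rewrite -scaleN1r DZ mulN1r.
have DB u v w : D (u - v) w = D u w - D v w by rewrite DD DN.
have bil := @isBilinear.Build R X X R *%R (idfun \; *%R) D
  (fun w u v => DB u v w)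
  (fun w u v => etrans (DC w (u - v))
    (etrans (DB u v w) (congr2 (fun p q => p - q) (DC u w) (DC v w))))
  (fun w a u => DZ a u w)
  (fun w a u => etrans (DC w (a *: u))
    (etrans (DZ a u w) (congr1 ( *%R a) (DC u w)))).
have herm : isHermitianSesquilinear R X false idfun D.
  by split=> u v; rewrite expr0 mul1r /=; exact: DC.
have pos : isDotProduct R X D.
  by split=> u u0; rewrite D0 /N exprn_gt0// normr_gt0.
pose dot : {dot X for idfun} := HB.pack_for {dot X for idfun} D bil herm pos.
exists dot => z; rewrite -[dot z z]/(D z z) D0.
by rewrite /N sqrtr_sqr normr_id.
Qed.

Theorem corollary2p13 (R : realType) (X : completeNormedModType R)
    (hX : strictly_convex X) :
  is_hilbert X <->
  (forall Y : submodClosed X,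
     has_dimension (subspace_of Y) 2 ->
     LP_property (subspace_of Y) (subspace_of Y)).
Proof.
split; first exact: hilbert_LP.
by move=> LP; apply: quadratic_norm_hilbert; exact: LP_quadratic_norm.
Qed.
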